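(* Let $n\ge2$, let $P$ be a positive regular polynomial $n$-tuple, let $m\in\mathbb N^n$, and let $\mathscr M_z$ be the multiplication $n$-tuple on $\mathscr H^2_m(\triangle^n_P)$. Then $$\sigma_p(\mathscr M_z^* )\cap(\mathbb C\times\mathbb C_*^{n-1})=\triangle^n_P.$$
   Context: $\mathbb N$ = positive integers, $\mathbb C_*=\mathbb C\setminus\{0\}$, $z\diamond w=(z_1w_1,\ldots,z_nw_n)$, and $\overline z$ is the entrywise conjugate. For $n\ge2$ let $\varphi(z)=\big(\frac{z_1}{z_2},\ldots,\frac{z_{n-1}}{z_n},z_n\big)$ for $z\in\mathbb C\times\mathbb C_*^{n-1}$. A polynomial $n$-tuple $P=(P_1,\ldots,P_n)$ in $\mathbb C[z_1,\ldots,z_n]$ is positive regular if for each $j$, $P_j$ has nonnegative coefficients and $P_j(z)=a_jz_j+\sum_{k=2}^{N_j}Q_{jk}(z)$ with $a_j>0$ and $Q_{jk}$ homogeneous of degree $k$. The $P$-triangle is $\triangle^n_P=\{z\in\mathbb C\times\mathbb C_*^{n-1}: P_j(\varphi(z)\diamond\overline{\varphi(z)})<1,\ j=1,\ldots,n\}$. For $m\in\mathbb N^n$, $\mathscr H^2_m(\triangle^n_P)$ is the reproducing kernel Hilbert space of holomorphic functions on $\triangle^n_P$ with kernel $$\mathscr K_{P,m}(z,w)=\prod_{j=2}^n\frac1{z_j\overline w_j}\prod_{j=1}^n\frac1{\big(1-P_j(\varphi(z)\diamond\overline{\varphi(w)})\big)^{m_j}}.$$ Each $z_j$ is a multiplier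 of this space; $\mathscr M_{z_j}$ is the bounded operator of multiplication by $z_j$, $\mathscr M_z=(\mathscr M_{z_1},\ldots,\mathscr M_{z_n})$ and $\mathscr M_z^*=(\mathscr M_{z_1}^*,\ldots,\mathscr M_{z_n}^* )$. The point spectrum $\sigma_p(T)$ of a commuting $n$-tuple $T$ is the set of $w\in\mathbb C^n$ with $\bigcap_{j}\ker(T_j-w_j)\ne\{0\}$. *)

(* Defs.v *)
From HB Require Import structures.
From mathcomp Require Import all_boot all_order all_algebra sesquilinear.
From mathcomp Require Import complex.
From mathcomp Require Import all_classical all_reals all_analysis.
(* The notations of [mpoly] clash with those of analysis. *)
From mathcomp Require Import -(notations) mpoly.

Set Implicit Arguments.
Unset Strict Implicit.
Unset Printing Implicit Defensive.

Import Order.TTheory GRing.Theory Num.Theory numFieldNormedType.Exports.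

Local Open Scope classical_set_scope.
Local Open Scope ring_scope.

(* Vectors of C^n are row vectors ['rV[R[i]]_n]; the coordinates z_1, ..., z_n
   are [z 0 j] for [j : 'I_n], so that z_1 has index 0. In [R[i]], [x < y]
   and [x <= y] imply that [y - x] is real. *)

Section Triangle.
Variables (R : realType) (n : nat).
Local Notation C := R[i].
Implicit Types (z w : 'rV[C]_n) (P : 'I_n -> mpoly.mpoly n C).

Definition punctured_space : set 'rV[C]_n :=
  [set z | forall j : 'I_n, (0 < j)%N -> z 0 j != 0].

Definition diamond z w : 'rV[C]_n := \row_j (z 0 j * w 0 j).

Definition conjv z : 'rV[C]_n := \row_j (z 0 j)^*.

(* [insub j.+1] is [None] exactly when [j] is the last index. *)
Definition phi z : 'rV[C]_n :=
  \row_j (if (insub j.+1 : option 'I_n) is Some k then z 0 j / z 0 k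
          else z 0 j).

Definition positive_regular P : Prop :=
  forall j : 'I_n,
    (forall alpha : mpoly.multinom n, 0 <= mpoly.mcoeff alpha (P j)) /\
    exists (a : C) (N : nat) (Q : nat -> mpoly.mpoly n C),
      [/\ 0 < a,
          forall k, (2 <= k <= N)%N -> Q k \is mpoly.ishomog1 k (@mpoly.mdeg n) &
          P j = a *: mpoly.mpolyX C (mpoly.mnm1 j)
                + \sum_(2 <= k < N.+1) Q k].

Definition triangle P : set 'rV[C]_n :=
  [set z | punctured_space z /\
    forall j : 'I_n, mpoly.meval (diamond (phi z) (conjv (phi z)) 0) (P j) < 1].

Definition triangle_kernel P (m : 'I_n -> nat) z w : C :=
  (\prod_(j < n | (0 < j)%N) (z 0 j * (w 0 j)^*)^-1) *
  \prod_(j < n)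
    ((1 - mpoly.meval (diamond (phi z) (conjv (phi w)) 0) (P j)) ^+ m j)^-1.

Definition holomorphic_on (D : set 'rV[C]_n) (f : 'rV[C]_n -> C) : Prop :=
  forall z : ('rV[C]_n : normedModType C),
    D z -> differentiable (f : 'rV[C]_n -> C^o) z.

End Triangle.

(* A reproducing kernel Hilbert space of holomorphic functions on [D] with
   kernel [K]: a Hilbert space each of whose elements [f] is a function
   [rkhs_fun f], of which only the values on [D] matter. The inner product is
   linear in its first argument. Up to a unitary map preserving [rkhs_fun] on
   [D], there is at most one such space for given [D] and [K]. *)
Record rkhs (R : realType) (n : nat) (D : set 'rV[R[i]]_n)
    (K : 'rV[R[i]]_n -> 'rV[R[i]]_n -> R[i]) := Rkhs {
  rkhs_space :> completeNormedModType R[i];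
  inner : {dot rkhs_space for (@Num.conj R[i])};
  rkhs_fun : rkhs_space -> 'rV[R[i]]_n -> R[i];
  norm_inner : forall f : rkhs_space, `|f| ^+ 2 = inner f f;
  rkhs_fun_linear : forall (a : R[i]) (f g : rkhs_space) z, D z ->
    rkhs_fun (a *: f + g) z = a * rkhs_fun f z + rkhs_fun g z;
  rkhs_fun_inj : forall f g : rkhs_space,
    (forall z, D z -> rkhs_fun f z = rkhs_fun g z) -> f = g;
  rkhs_fun_holomorphic : forall f : rkhs_space, holomorphic_on D (rkhs_fun f);
  rkhs_reproducing : forall w, D w ->
    exists k : rkhs_space,
      (forall z, D z -> rkhs_fun k z = K z w) /\
      (forall f : rkhs_space, rkhs_fun f w = inner f k)
}.

Section Operators.
Variables (R : realType) (n : nat) (D : set 'rV[R[i]]_n).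
Variables (K : 'rV[R[i]]_n -> 'rV[R[i]]_n -> R[i]) (H : rkhs D K).

Definition bounded_operator (T : H -> H) : Prop :=
  exists c : R[i], forall f : H, `|T f| <= c * `|f|.

Definition multiplication_operator (g : 'rV[R[i]]_n -> R[i]) (T : H -> H) :
    Prop :=
  forall (f : H) z, D z -> rkhs_fun (T f) z = g z * rkhs_fun f z.

Definition adjoint_operator (T S : H -> H) : Prop :=
  forall f g : H, inner H (T f) g = inner H f (S g).

Definition point_spectrum (T : 'I_n -> H -> H) : set 'rV[R[i]]_n :=
  [set w | \bigcap_(j in [set: 'I_n]) [set f : H | T j f - w 0 j *: f = 0]
           <> [set 0]].

End Operators.

(* Main.v *)
Require Import Defs.
From HB Require Import structures.
From mathcomp Require Import all_boot all_order all_algebra sesquilinear.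
From mathcomp Require Import complex.
From mathcomp Require Import all_classical all_reals all_analysis.
From mathcomp Require Import -(notations) mpoly.
From mathcomp Require Import ring.

Set Implicit Arguments.
Unset Strict Implicit.
Unset Printing Implicit Defensive.

Import Order.TTheory GRing.Theory Num.Theory numFieldNormedType.Exports.

Local Open Scope classical_set_scope.
Local Open Scope ring_scope.

(* Reproducing kernels are joint eigenvectors of the adjoints, which gives one
   inclusion. Conversely, let f <> 0 satisfy M_j^* f = conj(u_j) f, so that
   L = <., f> satisfies L (z_j g) = u_j L g, with u_j <> 0 for j >= 2. Put
     G(z, w) = prod_j (1 - P_j(phi(z) conj(phi(w)))) ^ m_j,
     s(z) = prod_(j >= 2) z_j.
   A monomial times G(., w) is a polynomial in z, and
     conj(s(w)) G(z, w) k_w(z) = 1 / s(z)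
   does not depend on w; applying L, neither does
     conj(s(w)) G(u, w) L(k_w),
   which is a nonzero constant b. If u is not in the triangle, let t be the
   least parameter where some P_j(t |phi(u)|^2) equals 1. For 0 < r < t the
   point w with phi(w) = r phi(u) lies in the triangle, and Cauchy-Schwarz gives
     |b|^2 <= |f|^2 G(u, w)^2 / G(w, w) <= |f|^2 G(u, w).
   As r tends to t, G(u, w) tends to 0: a contradiction. *)

(* [CauchySchwarz] of sesquilinear.v requires a finite dimensional space. *)
Lemma dot_CauchySchwarz (C : numClosedFieldType) (U : lmodType C)
    (form : {dot U for (@Num.conj C)}) (u v : U) :
  `|form u v| ^+ 2 <= form u u * form v v.
Proof.
have [->|v0] := eqVneq v 0; first by rewrite !linear0r normr0 expr0n.
have gt0 : 0 < form v v by apply: neq0_dnorm_gt0.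
have hC x y : (form x y)^* = form y x.
  by rewrite [RHS](hermC (form : {hermitian U for false & Num.conj})) mul1r.
have := dnorm_ge0 form (form v v *: u - form u v *: v).
rewrite linearBl !linearBr !linearZl_LR /= !linearZr_LR /= !hC.
rewrite /GRing.scale /= => h; rewrite -(ler_pM2r gt0) normCK hC -subr_ge0.
by apply: le_trans h _; rewrite le_eqVlt; apply/orP; left; apply/eqP; ring.
Qed.

(** * Restriction of polynomials to lines through the origin *)

Section Poly.
Variables (A : comNzRingType) (n : nat).
Implicit Types (P : mpoly.mpoly n A) (v : 'I_n -> A).

(** The map t -> P(t v) is kept as a univariate polynomial, so that root counting and the
    intermediate value theorem apply to it. *)
Definition ray P v : {poly A} :=
  \sum_(al <- mpoly.msupp P)
    (mpoly.mcoeff al P * \prod_i v i ^+ al i) *: 'X^(mpoly.mdeg al).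

Lemma horner_ray P v t : (ray P v).[t] = mpoly.meval (fun i => t * v i) P.
Proof.
rewrite mpoly.mevalE horner_sum; apply: eq_bigr => al _.
rewrite hornerZ hornerXn -mulrA; congr (_ * _).
under [RHS]eq_bigr do rewrite exprMn.
by rewrite big_split /= mulrC; congr (_ * _); rewrite prodrXr mpoly.mdegE.
Qed.

Lemma coef0_ray P v : mpoly.mcoeff mpoly.mnm0 P = 0 -> (ray P v)`_0 = 0.
Proof.
move=> P0; rewrite coef_sum big1_seq// => al _; rewrite coefZ coefXn.
have [al0|] := eqVneq (mpoly.mdeg al) 0%N; last by rewrite mulr0.
by move/eqP: al0; rewrite mpoly.mdeg_eq0 => /eqP->; rewrite P0 !mul0r.
Qed.

End Poly.

(** * Inequalities for polynomials with nonnegative coefficients *)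

Section NonnegPoly.
Variables (A : numDomainType) (q : {poly A}).
Hypothesis q_ge0 : forall i, 0 <= q`_i.

Lemma horner_ge0 t : 0 <= t -> 0 <= q.[t].
Proof.
by move=> t0; rewrite horner_coef sumr_ge0// => i _;
  rewrite mulr_ge0 ?exprn_ge0.
Qed.

(** Without a constant term, every monomial gains at least one factor [s], and the further factors
    are at most 1. *)
Lemma horner_contract s t : q`_0 = 0 -> 0 <= s <= 1 -> 0 <= t ->
  q.[s * t] <= s * q.[t].
Proof.
move=> q0 /andP[s0 s1] t0; rewrite !horner_coef mulr_sumr ler_sum//.
move=> -[[|i] hi] _ /=.
  by rewrite q0 !mul0r mulr0.
rewrite exprMn mulrCA ler_wpM2r ?mulr_ge0 ?exprn_ge0//.
by rewrite exprS ler_piMr// exprn_ile1.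
Qed.

End NonnegPoly.

Section Sesqui.
Variables (C : numClosedFieldType) (n : nat) (P : mpoly.mpoly n C).
Hypothesis P_ge0 : forall al, 0 <= mpoly.mcoeff al P.

Lemma coef_ray_ge0 (v : 'I_n -> C) i :
  (forall j, 0 <= v j) -> 0 <= (ray P v)`_i.
Proof.
move=> v0; rewrite coef_sum sumr_ge0// => al _; rewrite coefZ coefXn.
by rewrite mulr_ge0 ?ler0n// mulr_ge0// prodr_ge0// => j _; rewrite exprn_ge0.
Qed.

Lemma meval_ge0 (v : 'I_n -> C) : (forall j, 0 <= v j) -> 0 <= mpoly.meval v P.
Proof.
move=> v0; rewrite mpoly.mevalE sumr_ge0// => al _.
by rewrite mulr_ge0// prodr_ge0// => j _; rewrite exprn_ge0.
Qed.

(** Monomial by monomial this is 2|a||b| <= |a|^2 + |b|^2; nonnegative coefficients allow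
    summation. *)
Lemma norm_meval_le (x y : 'I_n -> C) :
  `|mpoly.meval (fun i => x i * (y i)^*) P| <=
  (mpoly.meval (fun i => x i * (x i)^*) P
   + mpoly.meval (fun i => y i * (y i)^*) P) / 2.
Proof.
rewrite !mpoly.mevalE -big_split mulr_suml /=.
apply: le_trans (ler_norm_sum _ _ _) _; apply: ler_sum => al _.
rewrite -mulrDr normrM ger0_norm// -mulrA ler_wpM2l//.
have E z w : \prod_i (z i * (w i)^*) ^+ al i
    = (\prod_i (z i) ^+ al i) * (\prod_(i < n) (w i : C) ^+ al i)^*.
  rewrite rmorph_prod -big_split; apply: eq_bigr => i _.
  by rewrite exprMn rmorphXn.
rewrite !E; set a := \prod_(i < n) x i ^+ al i.
set b := \prod_(i < n) y i ^+ al i.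
rewrite normrM norm_conjC -!normCK ler_pdivlMr// mulr_natr.
rewrite -subr_ge0 (_ : _ - _ = (`|a| - `|b|) ^+ 2); last by ring.
by rewrite real_exprn_even_ge0 ?realB ?normr_real.
Qed.

End Sesqui.

(** * Univariate estimates near the parameter 1 *)

Lemma onem_exprn_le (A : numDomainType) (s : A) d :
  0 <= s <= 1 -> 1 - s ^+ d <= d%:R * (1 - s).
Proof.
move=> /andP[s0 s1]; elim: d => [|d IH]; first by rewrite expr0 subrr mul0r.
rewrite -natr1 mulrDl mul1r (_ : 1 - _ = (1 - s ^+ d) + s ^+ d * (1 - s)).
  by rewrite lerD// ler_piMl ?subr_ge0// exprn_ile1.
by rewrite exprS; ring.
Qed.

(** An explicit form of the limit as [s] tends to 1: the defect [1 - q.[s * t]] is at most a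
    constant times [1 - s], so [b] is below arbitrarily small quantities. *)
Lemma le_defect_eq0 (A : numFieldType) (q : {poly A}) (t b c : A) :
  (forall i, 0 <= q`_i) -> 0 <= t -> q.[t] = 1 -> 0 <= b -> 0 <= c ->
  (forall s, 0 < s < 1 -> b <= c * (1 - q.[s * t])) -> b = 0.
Proof.
move=> q0 t0 qt b0 c0 h.
pose d := size q.
(* Every exponent in [q] is below [d], so each term shrinks by a factor no smaller than [s ^+ d],
   and the terms sum to 1 at [t]. *)
have qs (s : A) : 0 <= s <= 1 -> s ^+ d <= q.[s * t].
  move=> /andP[s0 s1]; rewrite -[leLHS]mulr1 -qt !horner_coef mulr_sumr.
  apply: ler_sum => i _; rewrite exprMn mulrCA ler_wpM2l//.
  rewrite ler_wpM2r ?exprn_ge0//.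
  by rewrite ler_wiXn2l// ltnW.
apply/eqP/negPn/negP => bN0; have bp : 0 < b by rewrite lt_def bN0.
have k0 : 0 <= c * d%:R by rewrite mulr_ge0.
have den : 0 < 2 * (b + c * d%:R) by rewrite mulr_gt0// ltr_wpDr.
(* Chosen so that [e < 1] and [c * d%:R * e < b], which contradicts the bound at [s = 1 - e]. *)
pose e := b / (2 * (b + c * d%:R)).
have e0 : 0 < e by rewrite divr_gt0.
have e1 : e < 1.
  rewrite ltr_pdivrMr// mul1r mulrDr mulr_natl mulr2n -addrA ltrDl.
  by rewrite ltr_wpDr// mulr_ge0.
have s01 : 0 < 1 - e < 1 by rewrite subr_gt0 e1 ltrBlDr ltrDl.
have s01' : 0 <= 1 - e <= 1 by case/andP: s01 => /ltW-> /ltW->.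
have : b <= c * (d%:R * e).
  apply: le_trans (h _ s01) _; rewrite ler_wpM2l//.
  have := onem_exprn_le d s01'; rewrite subKr; apply: le_trans.
  by rewrite lerD2l lerN2 qs.
rewrite /e mulrA mulrCA -{1}[b]mulr1 ler_pM2l// ler_pdivlMr// mul1r.
rewrite (_ : 2 * _ = c * d%:R + (c * d%:R + 2 * b)); last by ring.
by rewrite gerDl lt_geF// ltr_wpDl// mulr_gt0.
Qed.

Lemma exists_nonroot_near1 (A : numFieldType) (p : {poly A}) (e : A) :
  p != 0 -> 0 < e -> exists s, [/\ 0 < s, s < 1, 1 - s < e & p.[s] != 0].
Proof.
move=> p0 e0.
(* This [e'] is below both 1 and [e]. The points [1 - e' / k.+1%:R] for [k < size p] are distinct
   and too many to be all roots of [p]. *)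
pose e' := e / (1 + e); have e1 : 0 < 1 + e by rewrite addr_gt0.
have e'0 : 0 < e' by rewrite divr_gt0.
have e'1 : e' < 1 by rewrite ltr_pdivrMr// mul1r ltrDr.
have e'e : e' < e by rewrite ltr_pdivrMr// mulrDr mulr1 ltrDl mulr_gt0.
pose u (k : nat) : A := 1 - e' / k.+1%:R.
have uK k : 1 - u k = e' / k.+1%:R by rewrite subKr.
have ule k : e' / k.+1%:R <= e'.
  by rewrite ler_pdivrMr// ler_peMr ?ler1n// ltW.
have [k _ hk] : exists2 k, (k < size p)%N & p.[u k] != 0.
  apply: contrapT => hN; have := @max_poly_roots _ p (mkseq u (size p)) p0.
  rewrite size_mkseq ltnn => hh; suff: false by [].
  apply: hh.
    apply/allP => x /mapP[k]; rewrite mem_iota add0n => /= kp ->.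
    by apply/negPn/negP => hk; apply: hN; exists k.
  rewrite map_inj_uniq ?iota_uniq// => i j /(congr1 (fun x => 1 - x)).
  rewrite !uK => /(mulfI (lt0r_neq0 e'0))/invr_inj/eqP.
  by rewrite eqr_nat eqSS => /eqP.
exists (u k); split => //; last by rewrite uK (le_lt_trans (ule k)).
  by rewrite subr_gt0 (le_lt_trans (ule k)).
by rewrite ltrBlDr ltrDl divr_gt0.
Qed.

(** * The first parameter at which one of finitely many polynomials reaches 1 *)

Section FirstExit.
Variable R : rcfType.
Local Notation C := R[i].
Local Open Scope complex_scope.

(** Nonnegative complex coefficients are real, so [q] comes from a real polynomial, to which the
    intermediate value theorem applies. *)
Lemma nonneg_poly_ivt (q : {poly C}) : (forall i, 0 <= q`_i) -> q`_0 = 0 ->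
  1 <= q.[1] -> exists2 t : R, 0 < t <= 1 & q.[t%:C] = 1.
Proof.
move=> q0 q00 q1; pose r := map_poly (@complex.Re R) q.
have Er : q = map_poly (real_complex R) r.
  apply/polyP => i; rewrite coef_map coef_map_id0 //= RRe_real//.
  exact: ger0_real.
have Eh t : q.[t%:C] = (r.[t])%:C by rewrite {1}Er horner_map.
have r0 : r.[0] = 0 by rewrite horner_coef0 coef_map_id0 // q00.
have r1 : 1 <= r.[1] by rewrite -lecR -Eh.
have [|t] := @poly_ivt R (r - 1) 0 1 ler01.
  rewrite !hornerE r0 !subr_ge0; apply/andP; split; rewrite ?subr_le0 //.
move=> /andP[t0 t1]; rewrite rootE !hornerE subr_eq0 => /eqP rt.
exists t; last by rewrite Eh rt.
rewrite t1 andbT lt_def t0 andbT; apply: contra_eqN rt => /eqP ->.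
by rewrite r0 eq_sym oner_eq0.
Qed.

Lemma first_exit n (q : 'I_n -> {poly C}) (j : 'I_n) :
  (forall i k, 0 <= (q i)`_k) -> (forall i, (q i)`_0 = 0) -> 1 <= (q j).[1] ->
  exists (t : C) (k : 'I_n), [/\ 0 < t <= 1, (q k).[t] = 1 &
    forall i s, 0 < s < 1 -> (q i).[s * t] < 1].
Proof.
move=> q0 q00 qj.
have H i : exists t : R, [/\ 0 < t, t <= 1, (q i).[t%:C] <= 1 &
    if 1 <= (q i).[1] then (q i).[t%:C] = 1 else t = 1].
  have [hi|hi] := boolP (1 <= (q i).[1]).
    have [t /andP[]] := nonneg_poly_ivt (q0 i) (q00 i) hi.
    by exists t; split => //; rewrite q1.
  exists 1; split => //.
  rewrite real_leNgt ?ger0_real ?horner_ge0//.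
  by apply: contraNN hi => /ltW.
have [tau tauP] := choice H.
(* The minimum runs only over the polynomials that reach 1, so that [k] does reach it. The others
   have the default time 1, hence [tau k] is minimal overall. *)
have [k hk kmin] := arg_minP tau (qj : (fun i => 1 <= (q i).[1]) j).
have kmin' i : tau k <= tau i.
  have [_ _ _ +] := tauP i; case: ifP => [hi _|_ ->]; first exact: kmin.
  by have [] := tauP k.
have [k0 k1 _ +] := tauP k; rewrite hk => qk.
exists (tau k)%:C, k; split => //.
  by move: k0 k1; rewrite -ltcR -lecR rmorph0 rmorph1 => -> ->.
move=> i s /andP[s0 s1]; have [i0 _ i1 _] := tauP i.
have ki : (tau k / tau i)%:C <= 1.
  by rewrite -(rmorph1 (real_complex R)) lecR ler_pdivrMr// mul1r.
have ki0 : 0 <= (tau k / tau i)%:C.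
  by rewrite -(rmorph0 (real_complex R)) lecR divr_ge0 ?ltW.
(* Measured from [tau i], where [q i] is at most 1, the time [s * tau k] is a contraction by a
   factor at most [s < 1]. *)
rewrite (_ : s * _ = (s * (tau k / tau i)%:C) * (tau i)%:C); last first.
  by rewrite -mulrA -rmorphM divfK// gt_eqF.
apply: (@le_lt_trans _ _ (s * (tau k / tau i)%:C * (q i).[(tau i)%:C])).
  apply: horner_contract => //; last first.
    by rewrite -(rmorph0 (real_complex R)) lecR ltW.
  by rewrite mulr_ge0 ?(ltW s0)// mulr_ile1 ?(ltW s0) ?(ltW s1).
apply: le_lt_trans s1; rewrite -mulrA ler_piMr ?(ltW s0)//.
rewrite mulr_ile1// horner_ge0//.
by rewrite -(rmorph0 (real_complex R)) lecR ltW.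
Qed.

End FirstExit.

(** * Dilations, conjugation and the denominator of the kernel *)

Section Geometry.
Variables (R : realType) (n : nat).
Local Notation C := R[i].
Implicit Types (z w : 'rV[C]_n) (P : 'I_n -> mpoly.mpoly n C).

(** Consecutive weights differ by one and the last is 1 (indices start at 0), which makes [phi] turn
    this into scalar multiplication by [t]. *)
Definition dil (t : C) z : 'rV[C]_n := \row_j (t ^+ (n - j) * z 0 j).

Lemma phi_dil t z j : t != 0 -> phi (dil t z) 0 j = t * phi z 0 j.
Proof.
move=> t0; rewrite !mxE; case: insubP => [k _ Ek|].
  rewrite !mxE Ek (_ : (n - j = (n - j.+1).+1)%N); last by rewrite subnSK.
  by rewrite exprS invfM -!mulrA [z 0 j * (_ * _)]mulrCA mulVKf ?expf_neq0.
rewrite -leqNgt => nj; have -> : (n - j = 1)%N.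
  by apply/eqP; rewrite eqn_leq subn_gt0 ltn_ord leq_subLR addn1 nj.
by rewrite expr1.
Qed.

Lemma diamond_conjE z w :
  diamond z (conjv w) 0 = fun i => z 0 i * (w 0 i)^*.
Proof. by apply/funext => i; rewrite !mxE. Qed.

Lemma phi_conjv z : phi (conjv z) = conjv (phi z).
Proof.
apply/rowP => j; rewrite !mxE; case: insubP => [k _ _|_ //].
by rewrite !mxE rmorphM fmorphV.
Qed.

Lemma punctured_dil t z :
  t != 0 -> punctured_space z -> punctured_space (dil t z).
Proof.
by move=> t0 hz j j0; rewrite mxE mulf_neq0 ?expf_neq0// hz.
Qed.

(** The inequalities involve [phi z] only through the squared moduli of its entries. *)
Lemma triangle_conjv P z : triangle P z -> triangle P (conjv z).
Proof.
move=> [pz hz]; split=> [j j0|j]; first by rewrite mxE conjC_eq0 pz.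
rewrite phi_conjv; have := hz j; rewrite !diamond_conjE.
by congr (mpoly.meval _ _ < 1); apply/funext => i; rewrite !mxE conjCK mulrC.
Qed.

Lemma conjvK z : conjv (conjv z) = z.
Proof. by apply/rowP => j; rewrite !mxE conjCK. Qed.

Lemma positive_regular_coef0 P j :
  positive_regular P -> mpoly.mcoeff mpoly.mnm0 (P j) = 0.
Proof.
case/(_ j) => _ [a [N [Q [_ hQ ->]]]].
rewrite mpoly.mcoeffD mpoly.mcoeffZ mpoly.mcoeffX mpoly.mnm1_eq0 mulr0 add0r.
rewrite raddf_sum big_nat big1 //= => k kN.
apply: (mpoly.dhomog_nemf_coeff (hQ k kN)).
by rewrite /= mpoly.mdeg0 eq_sym -lt0n; case/andP: kN => /ltnW.
Qed.

Variables (P : 'I_n -> mpoly.mpoly n C) (m : 'I_n -> nat).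
Hypothesis P_ge0 : forall j al, 0 <= mpoly.mcoeff al (P j).
Hypothesis P_0 : forall j, mpoly.mcoeff mpoly.mnm0 (P j) = 0.
Hypothesis m_gt0 : forall j, (0 < m j)%N.

Definition kernel_denom z w : C :=
  \prod_(j < n)
    (1 - mpoly.meval (diamond (phi z) (conjv (phi w)) 0) (P j)) ^+ m j.

Lemma triangle_kernelE z w :
  triangle_kernel P m z w =
  ((\prod_(j < n | (0 < j)%N) z 0 j) * (\prod_(j < n | (0 < j)%N) w 0 j)^*)^-1
  * (kernel_denom z w)^-1.
Proof.
rewrite /triangle_kernel /kernel_denom !prodfV rmorph_prod -big_split.
by [].
Qed.

Lemma meval_phi_dil j t z w : t != 0 ->
  mpoly.meval (diamond (phi z) (conjv (phi (dil t w))) 0) (P j)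
  = (ray (P j) (diamond (phi z) (conjv (phi w)) 0)).[t^*].
Proof.
move=> t0; rewrite horner_ray !diamond_conjE.
by congr (mpoly.meval _ _); apply/funext => i; rewrite phi_dil// rmorphM mulrCA.
Qed.

Lemma meval_phi_dil2 j t z : 0 < t ->
  mpoly.meval (diamond (phi (dil t z)) (conjv (phi (dil t z))) 0) (P j)
  = (ray (P j) (diamond (phi z) (conjv (phi z)) 0)).[t * t].
Proof.
move=> t0; rewrite horner_ray !diamond_conjE.
congr (mpoly.meval _ _); apply/funext => i; rewrite phi_dil ?gt_eqF// rmorphM.
by rewrite /= (CrealP (gtr0_real t0)) mulrACA.
Qed.

Lemma diamond_phi_ge0 z i : 0 <= diamond (phi z) (conjv (phi z)) 0 i.
Proof. by rewrite diamond_conjE -normCK exprn_ge0. Qed.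

Lemma triangle_dil t z : 0 < t <= 1 -> triangle P z -> triangle P (dil t z).
Proof.
move=> /andP[t0 t1] [pz hz]; split.
  by apply: punctured_dil => //; rewrite gt_eqF.
move=> j; rewrite meval_phi_dil2//.
have cge k := coef_ray_ge0 (P_ge0 j) k (diamond_phi_ge0 z).
apply: (@le_lt_trans _ _ (ray (P j) (diamond (phi z) (conjv (phi z)) 0)).[1]).
  rewrite -[t * t]mulr1.
  apply: le_trans (horner_contract cge (coef0_ray _ (P_0 j)) _ ler01) _.
    by rewrite mulr_ge0 ?mulr_ile1 ?(ltW t0).
  by rewrite ler_piMl ?horner_ge0// mulr_ile1 ?(ltW t0).
rewrite horner_ray; under [X in mpoly.meval X]funext do rewrite mul1r.
exact: hz.
Qed.

(** If a factor vanished, [norm_meval_le] would bound 1 by the mean of two numbers below 1. *)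
Lemma kernel_denom_neq0 z w :
  triangle P z -> triangle P w -> kernel_denom z w != 0.
Proof.
move=> [_ hz] [_ hw]; apply/prodf_neq0 => j _; rewrite expf_neq0// subr_eq0.
apply/eqP => /esym E.
have := norm_meval_le (P_ge0 j) (phi z 0) (phi w 0).
rewrite -!diamond_conjE E normr1 real_leNgt; last 2 first.
- by rewrite real1.
- rewrite rpredM ?rpredV ?rpredD// ger0_real// meval_ge0// => i;
    exact: diamond_phi_ge0.
by move=> /negP; apply; rewrite ltr_pdivrMr// mul1r mulr2n ltrD.
Qed.

(** Along real dilations of [w] the denominator is a polynomial in [s] with value 1 at 0, hence not
    the zero polynomial. Neither point has to lie in the triangle. *)
Lemma exists_kernel_denom_neq0 z w e : 0 < e ->
  exists s, [/\ 0 < s, s < 1, 1 - s < e & kernel_denom z (dil s w) != 0].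
Proof.
move=> e0; pose v := diamond (phi z) (conjv (phi w)) 0.
pose p : {poly C} := \prod_j (1 - ray (P j) v) ^+ m j.
have hp t : p.[t] = \prod_j (1 - (ray (P j) v).[t]) ^+ m j.
  by rewrite horner_prod; apply: eq_bigr => j _; rewrite horner_exp !hornerE.
have p0 : p != 0.
  apply/eqP => p_eq0; have := hp 0; rewrite p_eq0 horner0 big1 => [/eqP|j _].
    by rewrite eq_sym oner_eq0.
  by rewrite horner_coef0 coef0_ray// subr0 expr1n.
have [s [s0 s1 se ps]] := exists_nonroot_near1 p0 e0.
exists s; split => //; apply: contraNN ps => /eqP <-; rewrite hp; apply/eqP.
apply: eq_bigr => j _.
by rewrite meval_phi_dil ?gt_eqF// (CrealP (gtr0_real s0)).
Qed.

End Geometry.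

(** * Multipliers and the eigenfunctional given by pairing with [f] *)

Section RkhsTheory.
Variables (R : realType) (n : nat) (D : set 'rV[R[i]]_n).
Variables (K : 'rV[R[i]]_n -> 'rV[R[i]]_n -> R[i]) (H : rkhs D K).
Local Notation C := R[i].
Implicit Types (g : H) (z w : 'rV[C]_n) (h : 'rV[C]_n -> C).

Lemma rkhs_fun0 z : D z -> rkhs_fun (0 : H) z = 0.
Proof.
move=> Dz; have := rkhs_fun_linear 1 (0 : H) 0 Dz.
by rewrite scaler0 addr0 mul1r => /esym/eqP; rewrite -subr_eq0 addrK => /eqP.
Qed.

Lemma rkhs_funZ a g z : D z -> rkhs_fun (a *: g) z = a * rkhs_fun g z.
Proof.
by move=> Dz; have := rkhs_fun_linear a g 0 Dz; rewrite rkhs_fun0// !addr0.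
Qed.

Lemma rkhs_funD (g1 g2 : H) z :
  D z -> rkhs_fun (g1 + g2) z = rkhs_fun g1 z + rkhs_fun g2 z.
Proof.
by move=> Dz; have := rkhs_fun_linear 1 g1 g2 Dz; rewrite scale1r mul1r.
Qed.

Lemma inner_conj (g1 g2 : H) : (inner H g1 g2)^* = inner H g2 g1.
Proof.
by rewrite [RHS](hermC (inner H : {hermitian H for false & Num.conj})) mul1r.
Qed.

Variables (f : H) (u : 'rV[C]_n).

(* [h] multiplies the space into itself and [<., f>] turns this into the scalar
   [h u]; the point [u] need not lie in [D]. *)
Definition eigen_multiplier h : Prop :=
  exists T : H -> H, forall g,
    (forall z, D z -> rkhs_fun (T g) z = h z * rkhs_fun g z) /\
    inner H (T g) f = h u * inner H g f.

Lemma eigen_multiplier_ext h1 h2 : {in D, h1 =1 h2} -> h1 u = h2 u ->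
  eigen_multiplier h1 -> eigen_multiplier h2.
Proof.
move=> hD hu [T TP]; exists T => g; have [Tz Tf] := TP g.
split=> [z Dz|]; last by rewrite -hu.
by rewrite Tz// hD// inE.
Qed.

Lemma eigen_multiplier_cst c : eigen_multiplier (fun=> c).
Proof.
exists (fun g => c *: g) => g; split=> [z Dz|]; first by rewrite rkhs_funZ.
by rewrite linearZl_LR.
Qed.

Lemma eigen_multiplierD h1 h2 : eigen_multiplier h1 -> eigen_multiplier h2 ->
  eigen_multiplier (fun z => h1 z + h2 z).
Proof.
move=> [T1 T1P] [T2 T2P]; exists (fun g => T1 g + T2 g) => g.
have [T1z T1f] := T1P g; have [T2z T2f] := T2P g.
split=> [z Dz|]; first by rewrite rkhs_funD// T1z// T2z// mulrDl.
by rewrite linearDl /= T1f T2f mulrDl.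
Qed.

Lemma eigen_multiplierM h1 h2 : eigen_multiplier h1 -> eigen_multiplier h2 ->
  eigen_multiplier (fun z => h1 z * h2 z).
Proof.
move=> [T1 T1P] [T2 T2P]; exists (fun g => T1 (T2 g)) => g.
have [T1z T1f] := T1P (T2 g); have [T2z T2f] := T2P g.
split=> [z Dz|]; first by rewrite T1z// T2z// mulrA.
by rewrite T1f T2f mulrA.
Qed.

(* Coordinates of [phi] are quotients of coordinates; that they multiply the
   space into itself is not assumed, so denominators are cleared instead. *)
Definition eigen_fraction h : Prop :=
  exists q, [/\ eigen_multiplier q, eigen_multiplier (fun z => q z * h z)
    & q u != 0].

Lemma eigen_fraction_cst c : eigen_fraction (fun=> c).
Proof.
exists (fun=> 1); split; last exact: oner_neq0.
  exact: eigen_multiplier_cst.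
exact: eigen_multiplier_cst.
Qed.

Lemma eigen_fractionD h1 h2 : eigen_fraction h1 -> eigen_fraction h2 ->
  eigen_fraction (fun z => h1 z + h2 z).
Proof.
move=> [q1 [q1m qh1 q1u]] [q2 [q2m qh2 q2u]].
exists (fun z => q1 z * q2 z); split; last by rewrite mulf_neq0.
  exact: eigen_multiplierM.
have := eigen_multiplierD (eigen_multiplierM q2m qh1)
  (eigen_multiplierM q1m qh2).
by apply: eigen_multiplier_ext => [z _|]; ring.
Qed.

Lemma eigen_fractionM h1 h2 : eigen_fraction h1 -> eigen_fraction h2 ->
  eigen_fraction (fun z => h1 z * h2 z).
Proof.
move=> [q1 [q1m qh1 q1u]] [q2 [q2m qh2 q2u]].
exists (fun z => q1 z * q2 z); split; last by rewrite mulf_neq0.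
  exact: eigen_multiplierM.
have := eigen_multiplierM qh1 qh2.
by apply: eigen_multiplier_ext => [z _|]; ring.
Qed.

Lemma eigen_fraction_sum (I : Type) (r : seq I) (F : I -> 'rV[C]_n -> C) :
  (forall i, eigen_fraction (F i)) ->
  eigen_fraction (fun z => \sum_(i <- r) F i z).
Proof.
move=> hF; elim: r => [|i r IH].
  by under eq_fun do rewrite big_nil; exact: eigen_fraction_cst.
by under eq_fun do rewrite big_cons; exact: eigen_fractionD.
Qed.

Lemma eigen_fraction_prod (I : Type) (r : seq I) (F : I -> 'rV[C]_n -> C) :
  (forall i, eigen_fraction (F i)) ->
  eigen_fraction (fun z => \prod_(i <- r) F i z).
Proof.
move=> hF; elim: r => [|i r IH].
  by under eq_fun do rewrite big_nil; exact: eigen_fraction_cst.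
by under eq_fun do rewrite big_cons; exact: eigen_fractionM.
Qed.

Lemma eigen_fractionX h k :
  eigen_fraction h -> eigen_fraction (fun z => h z ^+ k).
Proof.
move=> hh; elim: k => [|k IH].
  by under eq_fun do rewrite expr0; exact: eigen_fraction_cst.
by under eq_fun do rewrite exprS; exact: eigen_fractionM.
Qed.

Lemma eigen_fraction_meval (Q : mpoly.mpoly n C) (F : 'I_n -> 'rV[C]_n -> C) :
  (forall i, eigen_fraction (F i)) ->
  eigen_fraction (fun z => mpoly.meval (F^~ z) Q).
Proof.
move=> hF; under eq_fun do rewrite mpoly.mevalE.
apply: eigen_fraction_sum => al; apply: eigen_fractionM.
  exact: eigen_fraction_cst.
by apply: eigen_fraction_prod => i; exact: eigen_fractionX.
Qed.

Hypothesis D_punctured : D `<=` @punctured_space R n.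
Hypothesis u_punctured : punctured_space u.
Hypothesis coord_multiplier :
  forall j : 'I_n, eigen_multiplier (fun z => z 0 j).

Lemma eigen_fraction_phi j : eigen_fraction (fun z => phi z 0 j).
Proof.
under eq_fun do rewrite mxE; case: insubP => [k _ Ek|_]; last first.
  exists (fun=> 1); split; last exact: oner_neq0.
    exact: eigen_multiplier_cst.
  by under eq_fun do rewrite mul1r.
have k0 : (0 < k)%N by rewrite Ek.
exists (fun z => z 0 k); split => //; last exact: u_punctured.
have := coord_multiplier j; apply: eigen_multiplier_ext => [z|].
  by rewrite inE => /D_punctured/(_ k k0) zk; rewrite mulrC divfK.
by rewrite mulrC divfK// u_punctured.
Qed.

Lemma eigen_fraction_denom P m w :
  eigen_fraction (fun z => kernel_denom P m z w).
Proof.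
apply: eigen_fraction_prod => j; apply: eigen_fractionX.
under eq_fun do rewrite diamond_conjE -mulN1r.
apply: eigen_fractionD; first exact: eigen_fraction_cst.
apply: eigen_fractionM; first exact: eigen_fraction_cst.
apply: (@eigen_fraction_meval _ (fun i z => phi z 0 i * (phi w 0 i)^*)) => i.
apply: eigen_fractionM; first exact: eigen_fraction_phi.
exact: eigen_fraction_cst.
Qed.

(** Multiplying by both denominators turns the identity on [D] into an equality of elements of [H].
    Pairing it with [f] evaluates the multipliers at [u], where the denominators cancel. *)
Lemma eigen_fraction_eq h1 h2 g1 g2 : eigen_fraction h1 -> eigen_fraction h2 ->
  (forall z, D z -> h1 z * rkhs_fun g1 z = h2 z * rkhs_fun g2 z) ->
  h1 u * inner H g1 f = h2 u * inner H g2 f.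
Proof.
move=> [q1 [q1m qh1 q1u]] [q2 [q2m qh2 q2u]] E.
have [T1 /(_ g1)[T1z T1f]] := eigen_multiplierM q2m qh1.
have [T2 /(_ g2)[T2z T2f]] := eigen_multiplierM q1m qh2.
have T12 : T1 g1 = T2 g2.
  apply: rkhs_fun_inj => z Dz; rewrite T1z// T2z//.
  by rewrite -!mulrA E// mulrCA.
apply: (mulfI q1u); apply: (mulfI q2u).
have := congr1 (fun g => inner H g f) T12; rewrite /= T1f T2f => e.
by rewrite !mulrA in e *; rewrite e [q1 u * q2 u]mulrC.
Qed.

End RkhsTheory.

(** * Joint eigenvalues lie in the triangle, up to conjugation *)

Section JointEigenvector.
Variables (R : realType) (n : nat).
Local Notation C := R[i].
Variables (P : 'I_n -> mpoly.mpoly n C) (m : 'I_n -> nat).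
Variable H : rkhs (triangle P) (triangle_kernel P m).
Hypothesis P_ge0 : forall j al, 0 <= mpoly.mcoeff al (P j).
Hypothesis P_0 : forall j, mpoly.mcoeff mpoly.mnm0 (P j) = 0.
Hypothesis m_gt0 : forall j, (0 < m j)%N.

Local Notation tailprod z := (\prod_(j < n | (0 < j)%N) z 0 j).

Lemma tailprod_neq0 z : @punctured_space R n z -> tailprod z != 0.
Proof. by move=> pz; apply/prodf_neq0 => j; exact: pz. Qed.

Lemma exists_dil_neq0 (g : H) w : triangle P w -> rkhs_fun g w != 0 ->
  exists2 e : C, 0 < e & forall s, 0 < s -> s < 1 -> 1 - s < e ->
    rkhs_fun g (dil s w) != 0.
Proof.
move=> Dw gw; have := differentiable_continuous (rkhs_fun_holomorphic g Dw).
move=> /cvgrPdist_lt /(_ `|rkhs_fun g w|); rewrite normr_gt0 => /(_ gw).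
move=> /nbhs_ballP[d /= d0 hd].
pose S : C := \sum_(j < n) `|w 0 j|.
have S0 : 0 <= S by rewrite sumr_ge0.
have den : 0 < 1 + n%:R * S by rewrite ltr_wpDr// mulr_ge0.
(* By [onem_exprn_le], dilation by [s] moves each coordinate of [w] by at most [n%:R * (1 - s) * S];
   the summand 1 keeps the denominator positive. *)
exists (d / (1 + n%:R * S)) => [|s s0 s1 sd]; first by rewrite divr_gt0.
have : `|rkhs_fun g w - rkhs_fun g (dil s w)| < `|rkhs_fun g w|.
  apply: hd; split=> // i j; rewrite ord1 /ball /= mxE.
  rewrite -[X in X - _]mul1r -mulrBl normrM.
  have s01 : 0 <= s <= 1 by rewrite (ltW s0) ltW.
  rewrite ger0_norm ?subr_ge0 ?exprn_ile1 ?(ltW s0) ?(ltW s1)//.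
  apply: (@le_lt_trans _ _ (n%:R * (1 - s) * S)).
    apply: ler_pM => //.
    - by rewrite subr_ge0 exprn_ile1 ?(ltW s0) ?(ltW s1).
    - apply: le_trans (onem_exprn_le _ s01) _.
      by rewrite ler_wpM2r ?subr_ge0 ?(ltW s1)// ler_nat leq_subr.
    - by rewrite /S (bigD1 j)//= lerDl sumr_ge0.
  rewrite mulrAC mulrC; move: sd; rewrite ltr_pdivlMr//; apply: le_lt_trans.
  by rewrite ler_wpM2l ?subr_ge0 ?(ltW s1)// lerDr.
by apply: contraTneq => ->; rewrite subr0 ltxx.
Qed.

Variables (f : H) (u : 'rV[C]_n).
Hypothesis f_neq0 : f <> 0.
Hypothesis u_punctured : punctured_space u.
Hypothesis coord_multiplier :
  forall j : 'I_n, eigen_multiplier f u (fun z => z 0 j).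

(** Before pairing with [f], both sides are the function [(tailprod z)^-1] on the triangle;
    [eigen_fraction_eq] transfers the identity to [u]. *)
Lemma inner_reproducing w1 w2 (k1 k2 : H) : triangle P w1 -> triangle P w2 ->
  (forall z, triangle P z -> rkhs_fun k1 z = triangle_kernel P m z w1) ->
  (forall z, triangle P z -> rkhs_fun k2 z = triangle_kernel P m z w2) ->
  (tailprod w1)^* * kernel_denom P m u w1 * inner H k1 f =
  (tailprod w2)^* * kernel_denom P m u w2 * inner H k2 f.
Proof.
move=> D1 D2 k1P k2P.
have D_punct : triangle P `<=` @punctured_space R n by move=> z [].
have frac (w : 'rV[C]_n) :
    eigen_fraction f u (fun z => (tailprod w)^* * kernel_denom P m z w).
  apply: eigen_fractionM; first exact: eigen_fraction_cst.
  exact: (eigen_fraction_denom D_punct u_punctured coord_multiplier).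
apply: (eigen_fraction_eq (frac w1) (frac w2)) => z Dz.
have E (w : 'rV[C]_n) : triangle P w ->
    (tailprod w)^* * kernel_denom P m z w * triangle_kernel P m z w
    = (tailprod z)^-1.
  move=> Dw; rewrite triangle_kernelE mulrACA mulfV ?kernel_denom_neq0//.
  rewrite mulr1 invfM mulrCA mulfV ?mulr1//.
  by rewrite conjC_eq0 tailprod_neq0//; case: Dw.
by rewrite k1P// k2P// !E.
Qed.

Lemma joint_eigen_triangle : triangle P u.
Proof.
split=> // j; rewrite real_ltNge ?real1 ?ger0_real//; last first.
  by apply: meval_ge0 => // i; exact: diamond_phi_ge0.
apply/negP => Pj1; pose v := diamond (phi u) (conjv (phi u)) 0.
have v0 i : 0 <= v i by exact: diamond_phi_ge0.
pose q i := ray (P i) v.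
have q0 i k : 0 <= (q i)`_k by apply: coef_ray_ge0.
have q00 i : (q i)`_0 = 0 by apply: coef0_ray.
have qj : 1 <= (q j).[1].
  rewrite horner_ray; under [X in mpoly.meval X]funext do rewrite mul1r.
  exact: Pj1.
have [t [k [/andP[t0 t1] qk q_lt1]]] := first_exit q0 q00 qj.
have [w0 [Dw0 fw0]] : exists w0, triangle P w0 /\ rkhs_fun f w0 != 0.
  apply: contrapT => hN; apply: f_neq0; apply: rkhs_fun_inj => z Dz.
  rewrite rkhs_fun0//; apply/eqP/negPn/negP => fz; apply: hN.
  by exists z.
have [e e0 fe] := exists_dil_neq0 Dw0 fw0.
(* As [u] is now outside the triangle, the denominator could vanish at [w0]. A slight dilation makes
   it nonzero while keeping [f] nonzero, so [b] below is nonzero. *)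
have [s [s0 s1 se du]] := exists_kernel_denom_neq0 m P_0 u w0 e0.
pose w1 := dil s w0.
have Dw1 : triangle P w1 by apply: triangle_dil => //; rewrite s0 ltW.
have [k1 [k1P k1f]] := rkhs_reproducing H Dw1.
pose b := (tailprod w1)^* * kernel_denom P m u w1 * inner H k1 f.
have b_neq0 : b != 0.
  rewrite !mulf_neq0 ?conjC_eq0 ?tailprod_neq0//; first by case: Dw1.
  by rewrite -inner_conj conjC_eq0 -k1f; exact: fe.
suff : `|b| ^+ 2 = 0 by move/eqP; rewrite expf_eq0 normr_eq0 (negPf b_neq0).
apply: (@le_defect_eq0 _ (q k) t _ (inner H f f)) => //; first exact: ltW.
(* Here [phi w] is [r * t] times [phi u]. The pairing of [u] with [w] yields [q i] at [r * t], and
   that of [w] with itself yields [q i] at the square, which is smaller. *)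
move=> r /andP[r0 r1]; pose w := dil (r * t) u.
have rt0 : 0 < r * t by exact: mulr_gt0.
have rt1 : r * t <= 1 by rewrite mulr_ile1 ?(ltW r0) ?(ltW r1) ?(ltW t0).
have q_mono i : (q i).[r * t * (r * t)] <= (q i).[r * t].
  apply: le_trans (horner_contract (q0 i) (q00 i) _ (ltW rt0)) _.
    by rewrite (ltW rt0).
  by rewrite ler_piMl// horner_ge0// ltW.
have qr1 i : (q i).[r * t] < 1 by apply: q_lt1; rewrite r0.
have qr0 i : 0 <= (q i).[r * t] by rewrite horner_ge0// ltW.
have Dw : triangle P w.
  split; first by apply: punctured_dil => //; rewrite gt_eqF.
  by move=> i; rewrite meval_phi_dil2// (le_lt_trans (q_mono i)).
have duw : kernel_denom P m u w = \prod_i (1 - (q i).[r * t]) ^+ m i.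
  apply: eq_bigr => i _; rewrite meval_phi_dil ?gt_eqF//.
  by rewrite (CrealP (gtr0_real rt0)).
have dww : kernel_denom P m w w = \prod_i (1 - (q i).[r * t * (r * t)]) ^+ m i.
  by apply: eq_bigr => i _; rewrite meval_phi_dil2.
have duw0 : 0 < kernel_denom P m u w.
  by rewrite duw prodr_gt0// => i _; rewrite exprn_gt0// subr_gt0.
have dw_le : kernel_denom P m u w <= kernel_denom P m w w.
  rewrite duw dww ler_prod// => i _.
  rewrite exprn_ge0 ?subr_ge0 ?(ltW (qr1 i))//=.
  by rewrite lerXn2r ?nnegrE ?subr_ge0 ?(ltW (qr1 i)) ?(le_trans (q_mono i))
    ?(ltW (qr1 i))// lerD2l lerN2.
(* All factors lie between 0 and 1, and the exponent [m k] is at least 1, so one copy of the [k]-th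
   factor bounds the product. *)
have duw_le : kernel_denom P m u w <= 1 - (q k).[r * t].
  rewrite duw (bigD1 k)//= -[leRHS]mulr1.
  rewrite ler_pM ?exprn_ge0 ?subr_ge0 ?(ltW (qr1 _))//.
  - by rewrite prodr_ge0// => i _; rewrite exprn_ge0 ?subr_ge0 ?(ltW (qr1 _)).
  - by rewrite -(prednK (m_gt0 k)) exprS ler_piMr ?exprn_ile1
      ?subr_ge0 ?gerBl ?(ltW (qr1 _)).
  - rewrite prodr_ile1// => i _.
    by rewrite exprn_ge0 ?exprn_ile1 ?subr_ge0 ?gerBl ?(ltW (qr1 _)).
have [kw [kwP kwf]] := rkhs_reproducing H Dw.
rewrite /b (inner_reproducing Dw1 Dw k1P kwP).
have dww0 : 0 < kernel_denom P m w w := lt_le_trans duw0 dw_le.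
have tw0 : tailprod w != 0 by apply: tailprod_neq0; case: Dw.
rewrite !normrM norm_conjC !exprMn (ger0_norm (ltW duw0)).
apply: (@le_trans _ _ (`|tailprod w| ^+ 2 * kernel_denom P m u w ^+ 2
   * (inner H kw kw * inner H f f))).
  by rewrite ler_wpM2l ?dot_CauchySchwarz// mulr_ge0 ?exprn_ge0// ltW.
rewrite -kwf kwP// triangle_kernelE -normCK.
(* After Cauchy-Schwarz the factor [tailprod w] cancels against the kernel on the diagonal; the
   remaining quotient is at most 1 by [dw_le]. *)
rewrite [leLHS](_ : _ = inner H f f * (kernel_denom P m u w *
  (kernel_denom P m u w / kernel_denom P m w w))); last first.
  have a0 : `|tailprod w| != 0 by rewrite normr_eq0.
  by move: `|tailprod w| a0 => a a0; field; rewrite a0 gt_eqF.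
rewrite ler_wpM2l ?dnorm_ge0//; apply: le_trans duw_le.
by rewrite ler_piMr ?(ltW duw0)// ler_pdivrMr// mul1r.
Qed.

End JointEigenvector.

Theorem theorem6p4 (R : realType) (n : nat)
    (P : 'I_n -> mpoly.mpoly n R[i]) (m : 'I_n -> nat)
    (H : rkhs (triangle P) (triangle_kernel P m))
    (M Mstar : 'I_n -> {linear H -> H})
    (hn : (2 <= n)%N)
    (hP : positive_regular P)
    (hm : forall j, (0 < m j)%N)
    (hMbounded : forall j, bounded_operator (M j))
    (hM : forall j,
      multiplication_operator (fun z : 'rV[R[i]]_n => z 0 j) (M j))
    (hMstar : forall j, adjoint_operator (M j) (Mstar j)) :
  point_spectrum Mstar `&` @punctured_space R n = triangle P.
Proof.
have P_ge0 j al : 0 <= mpoly.mcoeff al (P j) by case: (hP j).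
have P_0 j : mpoly.mcoeff mpoly.mnm0 (P j) = 0 by apply: positive_regular_coef0.
apply/seteqP; split=> w.
  (* The inner product is conjugate linear in its second argument, so pairing with an eigenvector
     for [w] has eigenvalue [conjv w]. *)
  move=> [wS pw]; rewrite -[w]conjvK; apply: triangle_conjv.
  have [f fE f0] : exists2 f : H, (forall j, Mstar j f = w 0 j *: f) & f <> 0.
    apply: contrapT => hN; apply: wS; apply/seteqP; split=> f /=.
      move=> fE; apply: contrapT => f0; apply: hN; exists f => // j.
      by apply/eqP; rewrite -subr_eq0; apply/eqP; exact: fE.
    by move=> -> j _ /=; rewrite linear0 scaler0 subr0.
  apply: (@joint_eigen_triangle _ _ _ _ H P_ge0 P_0 hm f) => //.
    by move=> j j0; rewrite mxE conjC_eq0 pw.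
  move=> j; exists (M j) => g; split=> [z Dz|]; first exact: hM.
  by rewrite hMstar fE linearZr_LR mxE.
move=> Dw; split; last by case: Dw.
have Dc := triangle_conjv Dw.
(* The kernel at [conjv w] is the eigenvector for [w]: the difference [g] below has zero pairing
   with itself, by evaluating [M j g] at [conjv w]. *)
have [k [kP kf]] := rkhs_reproducing H Dc.
have eigen j : Mstar j k - w 0 j *: k = 0.
  apply/eqP; rewrite -(dnorm_eq0 (inner H)); apply/eqP.
  set g := _ - _; rewrite {2}/g linearBr /= linearZr_LR /= -hMstar -!kf.
  by rewrite hM// mxE subrr.
(* The kernel does not vanish on the diagonal of the triangle. *)
have k0 : k <> 0.
  move=> k0; have := kP _ Dc.
  rewrite k0 rkhs_fun0// triangle_kernelE => /esym/eqP.
  rewrite mulf_eq0 !invr_eq0 (negPf (kernel_denom_neq0 _ _ _ _))// orbF.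
  by rewrite -normCK expf_eq0 normr_eq0 (negPf (tailprod_neq0 _))//; case: Dc.
move=> E; apply: k0; have : [set 0] k by rewrite -E => j _; exact: eigen.
by [].
Qed.
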